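(* The groupoid $\mathcal G_{\mathrm{tight}}$ is Hausdorff.
   Context: $\mathbb N=\{0,1,2,\dots\}$. $S$ is the left shift on $\ell^2(\mathbb N)$ ($Se_0=0$, $Se_n=e_{n-1}$), $p$ is the rank-one projection onto $\mathbb Ce_0$, and $\bm t$ is the left shift on $\ell^2(\mathbb Z)$ ($\bm te_n=e_{n-1}$). The inverse semigroup $T$ of operators on $\ell^2(\mathbb N)\otimes\ell^2(\mathbb N)\otimes\ell^2(\mathbb Z)$: for $\bm n=(n_1,n_2),\bm m=(m_1,m_2)\in\mathbb N^2$, $r\in\mathbb Z$, let $B_1(r,\bm n,\bm m)=S^{*n_1}S^{m_1}\otimes S^{*n_1}S^{m_1}\otimes\bm t^r$ for $n_1=n_2$, $m_1=m_2$, $r=m_1-n_1$; $B_2(r,\bm n,\bm m)=S^{*n_1}S^{m_1}\otimes S^{*n_2}pS^{m_2}\otimes\bm t^r$ for $r=m_1-n_1$, $n_1\ge n_2$, $m_1\ge m_2$; $B_3(r,\bm n,\bm m)=S^{*n_1}pS^{m_1}\otimes S^{*n_2}S^{m_2}\otimes\bm t^r$ for $r=m_2-n_2$, $n_1\le n_2$, $m_1\le m_2$; $B_4(r,\bm n,\bm m)=S^{*n_1}pS^{m_1}\otimes S^{*n_2}pS^{m_2}\otimes\bm t^r$ for any $r\in\mathbb Z$. $T$ is the set of all these operators together with $0$, an inverse semigroup under operator product and adjoint. $E$ is its commutative semigroup of projections, ordered by $e\le f\iff fe=e$. $\widehat E_0$ is the set of nonzero semigroup homomorphisms $x:E\to\{0,1\}$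 with $x(0)=0$, with the subspace topology from $\{0,1\}^E$. A filter is a nonempty $A\subseteq E\setminus\{0\}$ that is upward closed and closed under products; ultrafilters are maximal filters. $\widehat E_\infty=\{x\in\widehat E_0:x^{-1}(1)\text{ is an ultrafilter}\}$ and $\widehat E_{\mathrm{tight}}$ is its closure in $\widehat E_0$. For $s\in T$ let $D_s=\{x\in\widehat E_0:x(ss^* )=1\}$, and for $x\in D_s$ let $(x\cdot s)(e)=x(ses^* )$. Let $\Sigma=\{(x,s):s\in T,\ x\in D_s\}$, with $(x,s)\sim(y,s')$ iff $x=y$ and $es=es'$ for some $e\in E$ with $x(e)=1$. $\mathcal G'=\Sigma/\sim$ is a groupoid with $[(x,s)][(x\cdot s,s')]=[(x,ss')]$, $[(x,s)]^{-1}=[(x\cdot s,s^* )]$, topologized by the basis $\Theta(U,s)=\{[(x,s)]:x\in U\}$, $s\in T$, $U\subseteq D_s$ open; its unit space is $\widehat E_0$ via $[(x,1)]\leftrightarrow x$, so $[(x,s)]$ has range $x$ and source $x\cdot s$. $\mathcal G_{\mathrm{tight}}$ is the reduction of $\mathcal G'$ to $\widehat E_{\mathrm{tight}}$ (elements with range and source in $\widehat E_{\mathrm{tight}}$), with the subspace topology. *)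

(* Defs.v *)
From HB Require Import structures.
From mathcomp Require Import all_boot all_order all_algebra zify ring.
From mathcomp Require Import complex generic_quotient.
From mathcomp Require Import all_classical all_reals ereal topology esum.

Set Implicit Arguments.
Unset Strict Implicit.
Unset Printing Implicit Defensive.

Import Order.TTheory GRing.Theory Num.Theory.

Local Open Scope classical_set_scope.
Local Open Scope ring_scope.
Local Open Scope complex_scope.

(* Partial injections p (with inverse q) of index sets. Every element of T is the
   operator (A f)(i) = f (p i), 0 where p is undefined, for such a p; this is
   how T is shown below to be closed under products and adjoints. *)

Definition pinv (I J : Type) (p : I -> option J) (q : J -> option I) : Prop :=
  forall i j, p i = Some j <-> q j = Some i.

Lemma pinvC (I J : Type) (p : I -> option J) q : pinv p q -> pinv q p.
Proof. by move=> h i j; split=> /h. Qed.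

Lemma pinv_id (I : Type) : pinv (@Some I) (@Some I).
Proof. by move=> i j; split=> -[->]. Qed.

Definition pcomp (I J K : Type) (p : I -> option J) (q : J -> option K) i := obind q (p i).

Lemma pinv_comp (I J K : Type) (p : I -> option J) p' (q : J -> option K) q' :
  pinv p p' -> pinv q q' -> pinv (pcomp p q) (pcomp q' p').
Proof.
move=> pp qq i k; rewrite /pcomp; split.
  by case E : (p i) => [j|//]/= /qq ->/=; exact/pp.
by case E : (q' k) => [j|//]/= /pp ->/=; exact/qq.
Qed.

Definition ptens (I J : Type) (p : I -> option I) (q : J -> option J)
    (ij : I * J) : option (I * J) :=
  if (p ij.1, q ij.2) is (Some i, Some j) then Some (i, j) else None.

Lemma pinv_tens (I J : Type) (p p' : I -> option I) (q q' : J -> option J) :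
  pinv p p' -> pinv q q' -> pinv (ptens p q) (ptens p' q').
Proof.
move=> pp qq [i j] [k l]; rewrite /ptens/=; split.
  case E : (p i) => [a|//]; case F : (q j) => [b|//] [<- <-].
  by move/pp : E => ->; move/qq : F => ->.
case E : (p' k) => [a|//]; case F : (q' l) => [b|//] [<- <-].
by move/pp : E => ->; move/qq : F => ->.
Qed.

Definition pleg (b : bool) (n m : nat) (i : nat) : option nat :=
  if (if b then i == n else (n <= i)%N) then Some (i - n + m)%N else None.

Definition ptrans (r : int) (k : int) : option int := Some (k + r).

Lemma pinv_leg b n m : pinv (pleg b n m) (pleg b m n).
Proof.
rewrite /pleg => i j; split; case: b.
- by case: eqP => // -> [<-]; rewrite subnn eqxx subnn.
- by case: leqP => // h [<-]; rewrite leq_addl; congr Some; lia.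
- by case: eqP => // -> [<-]; rewrite subnn eqxx subnn.
- by case: leqP => // h [<-]; rewrite leq_addl; congr Some; lia.
Qed.

Lemma pinv_trans r : pinv (ptrans r) (ptrans (- r)).
Proof.
move=> i j; rewrite /ptrans.
by split=> -[<-]; rewrite ?addrK// -addrA addNr addr0.
Qed.

Definition leg_dead (b b' : bool) (m k : nat) := b && (m < k)%N || b' && (k < m)%N.

Lemma pcomp_leg b b' n m k l i :
  pcomp (pleg b n m) (pleg b' k l) i =
  if leg_dead b b' m k then None else pleg (b || b') (n + (k - m)) (l + (m - k)) i.
Proof.
rewrite /pcomp /pleg /leg_dead.
by case: b; case: b' => /=; repeat (case: ifP => //=); move=> *; try (congr Some); lia.
Qed.

Definition idx : choiceType := (nat * nat * int)%type.

(* [b] and [c] tell whether the two N-legs contain the projection p. *)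
Definition pB (b c : bool) (r : int) (n m : nat * nat) : idx -> option idx :=
  ptens (ptens (pleg b n.1 m.1) (pleg c n.2 m.2)) (ptrans r).

Lemma pinv_B b c r n m : pinv (pB b c r n m) (pB b c (- r) m n).
Proof. by apply: pinv_tens (pinv_trans _); apply: pinv_tens; exact: pinv_leg. Qed.

Definition condB (b c : bool) (r : int) (n m : nat * nat) : bool :=
  match b, c with
  | false, false => [&& n.1 == n.2, m.1 == m.2 & r == m.1%:Z - n.1%:Z]
  | false, true => [&& r == m.1%:Z - n.1%:Z, (n.2 <= n.1)%N & (m.2 <= m.1)%N]
  | true, false => [&& r == m.2%:Z - n.2%:Z, (n.1 <= n.2)%N & (m.1 <= m.2)%N]
  | true, true => true
  end.

Definition set_elt (X : Type) (A : set X) (x : X) (Ax : A x) : set_type A :=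
  exist (fun x => x \in A) x (mem_set Ax).

Section Ell2.
Variable R : realType.

Definition square_summable (I : choiceType) (f : I -> R[i]) : Prop :=
  (\esum_(i in [set: I]) (complex.Re (f i) ^+ 2 + complex.Im (f i) ^+ 2)%:E < +oo)%E.

Definition ell2 (I : choiceType) : Type :=
  set_type [set f : I -> R[i] | square_summable f].

Definition seq_of (I : choiceType) (f : ell2 I) : I -> R[i] := set_val f.
Coercion seq_of : ell2 >-> Funclass.

Lemma ell2P (I : choiceType) (f : ell2 I) : square_summable f.
Proof. exact: (set_mem (valP f)). Qed.

Lemma ell2_inj (I : choiceType) (f g : ell2 I) : f =1 g -> f = g.
Proof. by move=> fg; apply: val_inj; apply/funext. Qed.

Lemma square_summable0 (I : choiceType) : square_summable (fun _ : I => 0 : R[i]).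
Proof. by rewrite /square_summable esum1// => i _; rewrite expr0n/= addr0. Qed.

Definition ell2_0 (I : choiceType) : ell2 I :=
  set_elt (@square_summable0 I).

(* The vector with coordinates [f]; it is the junk value 0 when [f] is not
   square summable. *)
Definition ell2_of (I : choiceType) (f : I -> R[i]) : ell2 I :=
  if pselect (square_summable f) is left h then set_elt h
  else ell2_0 I.

Lemma ell2_ofE (I : choiceType) (f : I -> R[i]) :
  square_summable f -> ell2_of f =1 f.
Proof. by rewrite /ell2_of; case: pselect. Qed.

Lemma ell2_ofK (I : choiceType) (f : ell2 I) : ell2_of f = f.
Proof. by apply: ell2_inj => i; rewrite ell2_ofE//; exact: ell2P. Qed.

(* Unordered sum of an absolutely summable real family. *)
Definition rsum (I : choiceType) (u : I -> R) : R :=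
  fine (\esum_(i in [set: I]) (Num.max (u i) 0)%:E)
  - fine (\esum_(i in [set: I]) (Num.max (- u i) 0)%:E).

Definition inner (I : choiceType) (f g : ell2 I) : R[i] :=
  rsum (fun i => complex.Re (f i * conjc (g i))) +i* rsum (fun i => complex.Im (f i * conjc (g i))).

Definition op (I : choiceType) := ell2 I -> ell2 I.

(* A map between Hilbert spaces that has an adjoint in this sense is
   automatically linear and bounded (Hellinger-Toeplitz). *)
Definition is_adjoint (I : choiceType) (A B : op I) : Prop :=
  forall f g, inner (A f) g = inner f (B g).

Definition op0 (I : choiceType) : op I := fun=> ell2_0 I.

Definition adj (I : choiceType) (A : op I) : op I :=
  xget (@op0 I) [set B | is_adjoint A B].

(* l^2(I) (x) l^2(J) is identified with l^2(I * J), the elementary tensor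
   f (x) g being (i, j) |-> f i * g j, and A (x) B is computed as
   (A (x) 1)(1 (x) B), each factor acting slice by slice. *)
Definition slicel (I J : choiceType) (F : ell2 (I * J)%type) (j : J) : ell2 I :=
  ell2_of (fun i => F (i, j)).
Definition slicer (I J : choiceType) (F : ell2 (I * J)%type) (i : I) : ell2 J :=
  ell2_of (fun j => F (i, j)).
Definition ampl (I J : choiceType) (A : op I) : op (I * J)%type :=
  fun F => ell2_of (fun ij => A (slicel F ij.2) ij.1).
Definition ampr (I J : choiceType) (B : op J) : op (I * J)%type :=
  fun F => ell2_of (fun ij => B (slicer F ij.1) ij.2).
Definition tens (I J : choiceType) (A : op I) (B : op J) : op (I * J)%type :=
  @ampl I J A \o @ampr I J B.

Definition shiftN : op nat := fun f => ell2_of (fun n => f n.+1).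
Definition proj0 : op nat := fun f => ell2_of (fun n => if n == 0%N then f 0%N else 0).
Definition shiftZ : op int := fun f => ell2_of (fun k : int => f (k + 1)).

Definition powZ (r : int) : op int :=
  match r with
  | Posz k => iter k shiftZ
  | Negz k => iter k.+1 (adj shiftZ)
  end.

Definition SS (n m : nat) : op nat := iter n (adj shiftN) \o iter m shiftN.
Definition SpS (n m : nat) : op nat :=
  iter n (adj shiftN) \o proj0 \o iter m shiftN.

Definition tens3 (A B : op nat) (C : op int) : op idx := tens (tens A B) C.

Definition B1 (r : int) (n m : nat * nat) : op idx :=
  tens3 (SS n.1 m.1) (SS n.1 m.1) (powZ r).
Definition B2 (r : int) (n m : nat * nat) : op idx :=
  tens3 (SS n.1 m.1) (SpS n.2 m.2) (powZ r).
Definition B3 (r : int) (n m : nat * nat) : op idx :=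
  tens3 (SpS n.1 m.1) (SS n.2 m.2) (powZ r).
Definition B4 (r : int) (n m : nat * nat) : op idx :=
  tens3 (SpS n.1 m.1) (SpS n.2 m.2) (powZ r).

Definition inT (A : op idx) : Prop :=
  A = @op0 idx \/
  exists (r : int) (n m : nat * nat),
    [\/ [/\ n.1 = n.2, m.1 = m.2, r = m.1%:Z - n.1%:Z & A = B1 r n m],
        [/\ r = m.1%:Z - n.1%:Z, (n.2 <= n.1)%N, (m.2 <= m.1)%N & A = B2 r n m],
        [/\ r = m.2%:Z - n.2%:Z, (n.1 <= n.2)%N, (m.1 <= m.2)%N & A = B3 r n m]
      | A = B4 r n m].

Definition pfun (I J : choiceType) (p : I -> option J) (f : J -> R[i]) : I -> R[i] :=
  fun i => if p i is Some j then f j else 0.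

Definition pop (I : choiceType) (p : I -> option I) : op I :=
  fun f => ell2_of (pfun p f).

Lemma esum_pinv (I J : choiceType) (p : I -> option J) q (a : I -> J -> \bar R) :
  pinv p q ->
  \esum_(i in [set: I]) (if p i is Some j then a i j else 0%E) =
  \esum_(j in [set: J]) (if q j is Some i then a i j else 0%E).
Proof.
move=> pq.
pose G := [set k : I * J | p k.1 = Some k.2].
transitivity (\esum_(k in G) a k.1 k.2).
  transitivity (\esum_(i in [set i | p i]) (if p i is Some j then a i j else 0%E)).
    rewrite [RHS]esum_mkcond; apply: eq_esum => i _.
    by case: ifPn => //; rewrite notin_setE/=; case: (p i) => // ? [].
  rewrite (reindex_esum G _ fst).
    by apply: eq_esum => k /= ->.
  split=> [k /= ->//|[i j] [i' j'] /[!inE]/= Hi Hj ii'|i /=].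
    by move: Hj; rewrite /G/= -ii'; move: Hi; rewrite /G/= => -> [->].
  by case E : (p i) => [j|//] _; exists (i, j).
transitivity (\esum_(j in [set j | q j]) (if q j is Some i then a i j else 0%E)).
  rewrite [RHS](reindex_esum G _ snd).
    by apply: eq_esum => k /= /pq ->.
  split=> [k /= /pq ->//|[i j] [i' j'] /[!inE]/= Hi Hj jj'|j /=].
    by move: Hj => /pq/=; rewrite -jj'; move: Hi => /pq/= -> [->].
  by case E : (q j) => [i|//] _; exists (i, j) => //; apply/pq.
rewrite esum_mkcond; apply: eq_esum => i _.
by case: ifPn => //; rewrite notin_setE/=; case: (q i) => // ? [].
Qed.

Lemma pfun_sq (I J : choiceType) (p : I -> option J) q (f : J -> R[i]) :
  pinv p q -> square_summable f -> square_summable (pfun p f).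
Proof.
move=> pq; apply: le_lt_trans; rewrite /pfun.
under eq_esum => i _.
  rewrite (_ : (_)%:E = if p i is Some j then (complex.Re (f j) ^+ 2 + complex.Im (f j) ^+ 2)%:E
    else 0%E); last by case: (p i) => //=; rewrite expr0n/= addr0.
over.
rewrite (esum_pinv _ pq); apply: le_esum => j _.
case: (q j) => [?|]; first exact: lexx.
by rewrite lee_fin addr_ge0 ?sqr_ge0.
Qed.

Lemma popE (I : choiceType) (p q : I -> option I) (f : ell2 I) : pinv p q ->
  pop p f =1 pfun p f.
Proof. by move=> pq; apply/ell2_ofE/(pfun_sq pq)/ell2P. Qed.

Lemma rsum_pinv (I J : choiceType) (p : I -> option J) q (a : I -> J -> R) :
  pinv p q ->
  rsum (fun i => if p i is Some j then a i j else 0) =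
  rsum (fun j => if q j is Some i then a i j else 0).
Proof.
move=> pq; congr (fine _ - fine _).
  pose b i j := (Num.max (a i j) 0)%:E.
  transitivity (\esum_(i in [set: I]) (if p i is Some j then b i j else 0%E)).
    by apply: eq_esum => i _; case: (p i) => //; rewrite maxxx.
  rewrite (esum_pinv _ pq); apply: eq_esum => j _.
  by case: (q j) => //; rewrite maxxx.
pose b i j := (Num.max (- a i j) 0)%:E.
transitivity (\esum_(i in [set: I]) (if p i is Some j then b i j else 0%E)).
  by apply: eq_esum => i _; case: (p i) => //; rewrite oppr0 maxxx.
rewrite (esum_pinv _ pq); apply: eq_esum => j _.
by case: (q j) => //; rewrite oppr0 maxxx.
Qed.

Lemma pop_adjoint (I : choiceType) (p q : I -> option I) :
  pinv p q -> is_adjoint (pop p) (pop q).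
Proof.
move=> pq f g; rewrite /inner.
have E (h : R[i] -> R) : h 0 = 0 ->
    rsum (fun i => h (pop p f i * conjc (g i))) = rsum (fun i => h (f i * conjc (pop q g i))).
  move=> h0; transitivity (rsum (fun i => if p i is Some j then h (f j * conjc (g i)) else 0)).
    congr rsum; apply/funext => i; rewrite (popE _ pq) /pfun.
    by case: (p i) => //; rewrite mul0r h0.
  rewrite (rsum_pinv (fun i j => h (f j * conjc (g i))) pq).
  congr rsum; apply/funext => i; rewrite (popE _ (pinvC pq)) /pfun.
  by case: (q i) => //; rewrite conjc0 mulr0 h0.
by rewrite (E (@complex.Re R))// (E (@complex.Im R)).
Qed.

Lemma rsum1 (I : choiceType) (i : I) (u : I -> R) :
  (forall j, j != i -> u j = 0) -> rsum u = u i.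
Proof.
move=> u0; rewrite /rsum.
have E (v : I -> R) : (forall j, j != i -> v j = 0) -> 0 <= v i ->
    \esum_(j in [set: I]) (v j)%:E = (v i)%:E.
  move=> v0 vi; rewrite -(@esum_set1 _ _ i (fun j => (v j)%:E))//.
  rewrite [RHS]esum_mkcond; apply: eq_esum => j _.
  by case: ifPn => //; rewrite notin_setE/= => /eqP /v0 ->.
rewrite (E (fun j => Num.max (u j) 0)) ?(E (fun j => Num.max (- u j) 0)) /=.
- case: (leP (u i) 0) => ui.
    by rewrite max_l ?oppr_ge0// sub0r opprK.
  by rewrite max_r ?oppr_le0 ?ltW// subr0.
- by move=> j /u0 ->; rewrite oppr0 maxxx.
- by rewrite le_max lexx orbT.
- by move=> j /u0 ->; rewrite maxxx.
- by rewrite le_max lexx orbT.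
Qed.

Lemma delta_sq (I : choiceType) (i : I) :
  square_summable (fun j => (j == i)%:R : R[i]).
Proof.
rewrite /square_summable.
pose a (j : I) : \bar R := (if j == i then 1 else 0)%:E.
rewrite (@eq_esum _ _ _ _ (fun j => if j \in [set i] then 1 else 0)%E).
  by rewrite -esum_mkcond esum_set1 ?lee01// ltry.
move=> j _; case: ifPn; rewrite ?inE ?notin_setE/=.
  by move=> ->; rewrite eqxx/= expr0n expr1n addr0.
by move=> /eqP/negPf ->; rewrite /= expr0n addr0.
Qed.

Lemma inner_delta (I : choiceType) (i : I) (h : ell2 I) :
  inner (ell2_of (fun j => (j == i)%:R)) h = conjc (h i).
Proof.
have E j : ell2_of (fun j => (j == i)%:R) j = (j == i)%:R.
  by rewrite ell2_ofE//; exact: delta_sq.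
rewrite /inner !(@rsum1 _ i) ?E ?eqxx ?mul1r.
- by case: (h i).
- by move=> j /negPf ji; rewrite E ji mul0r.
- by move=> j /negPf ji; rewrite E ji mul0r.
Qed.

Lemma adjointE (I : choiceType) (A B : op I) : is_adjoint A B -> adj A = B.
Proof.
move=> AB; have AA : is_adjoint A (adj A).
  by rewrite /adj; case: xgetP => [C _//|/(_ B)].
apply/funext => g; apply: ell2_inj => i; apply: (can_inj (@conjcK R)).
by rewrite -2!inner_delta -AA -AB.
Qed.

Lemma adj_pop (I : choiceType) (p q : I -> option I) :
  pinv p q -> adj (pop p) = pop q.
Proof. by move=> /pop_adjoint/adjointE. Qed.

Lemma pop_comp (I : choiceType) (p p' q q' : I -> option I) :
  pinv p p' -> pinv q q' -> pop p \o pop q = pop (pcomp p q).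
Proof.
move=> pp qq; apply/funext => f; apply: ell2_inj => i.
rewrite (popE _ (pinv_comp pp qq)) /= (popE _ pp) /pfun /pcomp.
by case: (p i) => //= j; rewrite (popE _ qq).
Qed.

Lemma slicelE (I J : choiceType) (F : ell2 (I * J)%type) j i :
  slicel F j i = F (i, j).
Proof.
rewrite /slicel ell2_ofE//.
apply: (@pfun_sq _ _ (fun i => Some (i, j))
  (fun k => if k.2 == j then Some k.1 else None) F); last exact: ell2P.
move=> a [b c] /=; split=> [[-> ->]|]; first by rewrite eqxx.
by case: eqP => // -> [->].
Qed.

Lemma slicerE (I J : choiceType) (F : ell2 (I * J)%type) j i :
  slicer F i j = F (i, j).
Proof.
rewrite /slicer ell2_ofE//.
apply: (@pfun_sq _ _ (fun j => Some (i, j))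
  (fun k => if k.1 == i then Some k.2 else None) F); last exact: ell2P.
move=> a [b c] /=; split=> [[-> ->]|]; first by rewrite eqxx.
by case: eqP => // -> [->].
Qed.

(* On homogeneous maps, in particular on linear ones, [tens] is the usual tensor
   product of operators: it maps f (x) g to A f (x) B g. *)
Definition homogeneous (I : choiceType) (A : op I) : Prop :=
  forall (c : R[i]) (f g : ell2 I), (forall i, g i = f i * c) ->
    forall i, A g i = A f i * c.

Lemma square_summable_tens (I J : choiceType) (f : I -> R[i]) (g : J -> R[i]) :
  square_summable f -> square_summable g ->
  square_summable (fun ij : I * J => f ij.1 * g ij.2).
Proof.
pose N (z : R[i]) : R := complex.Re z ^+ 2 + complex.Im z ^+ 2.
have N0 z : 0 <= N z by rewrite addr_ge0 ?sqr_ge0.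
have NM z w : N (z * w) = N z * N w by case: z w => a b [c d]; rewrite /N/=; ring.
have scale (K : choiceType) (a : R) (b : K -> \bar R) : 0 <= a ->
    (forall k, 0 <= b k)%E ->
    (\esum_(k in [set: K]) (a%:E * b k) <= a%:E * \esum_(k in [set: K]) b k)%E.
  move=> a0 b0; apply: ge_ereal_sup => _ [X [finX _] <-].
  rewrite -ge0_mule_fsumr//; apply: lee_wpmul2l; first by rewrite lee_fin.
  by apply: ereal_sup_ubound; exists X.
rewrite /square_summable => hf hg.
have g0 : (0 <= \esum_(j in [set: J]) (N (g j))%:E)%E by apply: esum_ge0 => j _; rewrite lee_fin.
have gfin : (\esum_(j in [set: J]) (N (g j))%:E \is a fin_num)%E by rewrite ge0_fin_numE.
rewrite -[X in esum X]setXTT -(@esum_esum _ _ _ setT (fun=> setT) (fun i j => (N (f i * g j))%:E)); last first.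
  by move=> i j _ _; rewrite lee_fin.
pose c := fine (\esum_(j in [set: J]) (N (g j))%:E)%E.
apply: (@le_lt_trans _ _ (\esum_(i in [set: I]) (c%:E * (N (f i))%:E))%E).
  apply: le_esum => i _; under eq_esum do rewrite NM EFinM.
  apply: le_trans (scale _ _ _ _ _) _ => //; first by move=> j; rewrite lee_fin.
  by rewrite /c fineK// muleC.
apply: le_lt_trans (scale _ _ _ _ _) _ => //.
- exact: fine_ge0.
- by move=> i; rewrite lee_fin.
- by rewrite lte_mul_pinfty// lee_fin fine_ge0.
Qed.

Lemma tensE (I J : choiceType) (A : op I) (B : op J) (f : ell2 I) (g : ell2 J)
    (F : ell2 (I * J)%type) :
  homogeneous A -> homogeneous B -> (forall i j, F (i, j) = f i * g j) ->
  forall i j, tens A B F (i, j) = A f i * B g j.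
Proof.
move=> hA hB FE.
have FB i j : ampr B F (i, j) = f i * B g j.
  have H i' j' : B (slicer F i') j' = f i' * B g j'.
    by rewrite (hB (f i') g) 1?mulrC// => k; rewrite slicerE FE mulrC.
  rewrite /ampr ell2_ofE//.
  rewrite (_ : (fun _ => _) = fun ij => f ij.1 * B g ij.2).
    exact: square_summable_tens (ell2P _) (ell2P _).
  by apply/funext => -[i' j'] /=.
move=> i j; have H i' j' : A (slicel (ampr B F) j') i' = A f i' * B g j'.
  by apply: hA => k; rewrite slicelE FB.
rewrite /tens /= /ampl ell2_ofE//.
rewrite (_ : (fun _ => _) = fun ij => A f ij.1 * B g ij.2).
  exact: square_summable_tens (ell2P _) (ell2P _).
by apply/funext => -[i' j'] /=.
Qed.

Lemma ampl_pop (I J : choiceType) (p p' : I -> option I) : pinv p p' ->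
  @ampl I J (pop p) = pop (ptens p (@Some J)).
Proof.
move=> pp; apply/funext => F; apply/(congr1 (@ell2_of _))/funext => -[i j].
rewrite (popE _ pp) /pfun /ptens/=.
by case: (p i) => // k; rewrite slicelE.
Qed.

Lemma ampr_pop (I J : choiceType) (p p' : J -> option J) : pinv p p' ->
  @ampr I J (pop p) = pop (ptens (@Some I) p).
Proof.
move=> pp; apply/funext => F; apply/(congr1 (@ell2_of _))/funext => -[i j].
rewrite (popE _ pp) /pfun /ptens/=.
by case: (p j) => // k; rewrite slicerE.
Qed.

Lemma tens_pop (I J : choiceType) (p p' : I -> option I) (q q' : J -> option J) :
  pinv p p' -> pinv q q' -> tens (pop p) (pop q) = pop (ptens p q).
Proof.
move=> pp qq; rewrite /tens (ampl_pop _ pp) (ampr_pop _ qq).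
rewrite (pop_comp (pinv_tens pp (@pinv_id J)) (pinv_tens (@pinv_id I) qq)).
congr pop; apply/funext => -[i j]; rewrite /pcomp /ptens/=.
by case: (p i) => //=; case: (q j).
Qed.

Lemma pop_id (I : choiceType) : pop (@Some I) = id.
Proof. by apply/funext => f; apply: ell2_inj => i; rewrite (popE _ (@pinv_id I)). Qed.

Lemma iter_pop (I : choiceType) (P Q : nat -> I -> option I) k :
  (forall k, pinv (P k) (Q k)) -> P 0%N = (@Some I) ->
  (forall k, P k.+1 = pcomp (P 1%N) (P k)) ->
  iter k (pop (P 1%N)) = pop (P k).
Proof.
move=> PQ P0 PS; elim: k => [|k IH]; first by rewrite P0 pop_id.
rewrite (PS k) -(pop_comp (PQ 1%N) (PQ k)) -IH.
by apply/funext => f.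
Qed.

Lemma shiftN_pop : shiftN = pop (pleg false 0 1).
Proof.
apply/funext => f; rewrite /shiftN /pop; congr ell2_of.
by apply/funext => i; rewrite /pfun /pleg/= subn0 addn1.
Qed.

Lemma proj0_pop : proj0 = pop (pleg true 0 0).
Proof.
apply/funext => f; rewrite /proj0 /pop; congr ell2_of.
by apply/funext => i; rewrite /pfun /pleg; case: eqP => // ->.
Qed.

Lemma shiftZ_pop : shiftZ = pop (ptrans 1).
Proof. by []. Qed.

Lemma iter_shiftN m : iter m shiftN = pop (pleg false 0 m).
Proof.
rewrite shiftN_pop; apply: (@iter_pop _ (pleg false 0) (fun m => pleg false m 0)).
- by move=> k; exact: pinv_leg.
- by apply/funext => i; rewrite /pleg leq0n subn0 addn0.
- by move=> k; apply/funext => i; rewrite /pcomp /pleg/=; congr Some; lia.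
Qed.

Lemma iter_shiftN_adj n : iter n (adj shiftN) = pop (pleg false n 0).
Proof.
rewrite shiftN_pop (adj_pop (pinv_leg _ _ _)).
apply: (@iter_pop _ (fun n => pleg false n 0) (pleg false 0)).
- by move=> k; exact: pinv_leg.
- by apply/funext => i; rewrite /pleg leq0n subn0 addn0.
- move=> k; apply/funext => i; rewrite /pcomp /pleg/=.
  case: (leqP 1 i) => /= h; last by rewrite ifF//; lia.
  by rewrite (_ : (k < i)%N = (k <= i - 1 + 0)%N); [case: ifP => // _; congr Some; lia|lia].
Qed.

Lemma SS_pop n m : SS n m = pop (pleg false n m).
Proof.
rewrite /SS iter_shiftN_adj iter_shiftN (pop_comp (pinv_leg _ _ _) (pinv_leg _ _ _)).
congr pop; apply/funext => i; rewrite pcomp_leg/=.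
by congr pleg; lia.
Qed.

Lemma SpS_pop n m : SpS n m = pop (pleg true n m).
Proof.
rewrite /SpS iter_shiftN_adj iter_shiftN proj0_pop.
rewrite [X in X \o _](pop_comp (pinv_leg false n 0) (pinv_leg true 0 0)).
rewrite (pop_comp (pinv_comp (pinv_leg false n 0) (pinv_leg true 0 0))
  (pinv_leg false 0 m)).
congr pop; apply/funext => i.
have -> : pcomp (pleg false n 0) (pleg true 0 0) = pleg true n 0.
  by apply/funext => j; rewrite pcomp_leg/= /leg_dead/=; congr pleg; lia.
by rewrite pcomp_leg/= /leg_dead/=; congr pleg; lia.
Qed.

Lemma powZ_pop r : powZ r = pop (ptrans r).
Proof.
case: r => k; rewrite /powZ.
  rewrite shiftZ_pop; apply: (@iter_pop _ (fun k => ptrans k%:Z) (fun k => ptrans (- k%:Z))).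
  - by move=> j; exact: pinv_trans.
  - by apply/funext => i; rewrite /ptrans addr0.
  - by move=> j; apply/funext => i; rewrite /pcomp /ptrans/=; congr Some; lia.
rewrite shiftZ_pop (adj_pop (pinv_trans _)).
rewrite (@iter_pop _ (fun k => ptrans (- k%:Z)) (fun k => ptrans (k%:Z)) k.+1)//.
- by move=> j; rewrite -{2}(opprK j%:Z); exact: pinv_trans.
- by apply/funext => i; rewrite /ptrans oppr0 addr0.
- by move=> j; apply/funext => i; rewrite /pcomp /ptrans/=; congr Some; lia.
Qed.

Lemma tens3_pop b c r (n m : nat * nat) :
  tens3 (pop (pleg b n.1 m.1)) (pop (pleg c n.2 m.2)) (pop (ptrans r)) = pop (pB b c r n m).
Proof.
rewrite /tens3 (tens_pop (pinv_leg _ _ _) (pinv_leg _ _ _)).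
by rewrite (tens_pop (pinv_tens (pinv_leg _ _ _) (pinv_leg _ _ _)) (pinv_trans _)).
Qed.

Lemma inTP (A : op idx) : inT A <-> A = @op0 idx \/
  exists b c r n m, condB b c r n m /\ A = pop (pB b c r n m).
Proof.
split=> -[->|]; try by left.
  move=> [r [n [m h]]]; right; case: h => [[h1 h2 h3 ->]|[h1 h2 h3 ->]|[h1 h2 h3 ->]|->].
  - exists false, false, r, n, m; split; first by rewrite /= h1 h2 h3 h1 h2 !eqxx.
    by rewrite -tens3_pop /B1 !SS_pop powZ_pop -h1 -h2.
  - exists false, true, r, n, m; split; first by rewrite /= h1 h2 h3 !eqxx.
    by rewrite -tens3_pop /B2 !SS_pop !SpS_pop powZ_pop.
  - exists true, false, r, n, m; split; first by rewrite /= h1 h2 h3 !eqxx.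
    by rewrite -tens3_pop /B3 !SS_pop !SpS_pop powZ_pop.
  - exists true, true, r, n, m; split=> //.
    by rewrite -tens3_pop /B4 !SpS_pop powZ_pop.
move=> [b [c [r [n [m [h ->]]]]]]; right; exists r, n, m; rewrite -tens3_pop.
case: b c h => -[] /=; rewrite -?SS_pop -?SpS_pop -?powZ_pop.
- by move=> _; constructor 4.
- by move=> /and3P[/eqP-> ? ?]; constructor 3.
- by move=> /and3P[/eqP-> ? ?]; constructor 2.
- by move=> /and3P[/eqP h1 /eqP h2 /eqP->]; constructor 1; rewrite /B1 {2}h1 {2}h2 -h1 -h2.
Qed.

End Ell2.

Arguments op0 {R I}.
Arguments adj_pop {R I p q}.
Arguments pop_comp {R I p p' q q'}.

Section InverseSemigroup.
Variable R : realType.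

Definition is_pop (A : op R idx) : Prop := exists p q, pinv p q /\ A = pop p.

Lemma op0_pop : (op0 : op R idx) = pop (fun=> None).
Proof.
by apply/funext => f; apply: ell2_inj => i; rewrite (@popE _ _ _ (fun=> None)).
Qed.

Lemma inT_pop A : inT A -> is_pop A.
Proof.
move=> /inTP[->|[b [c [r [n [m [_ ->]]]]]]].
  by exists (fun=> None), (fun=> None); split=> //; exact: op0_pop.
by exists (pB b c r n m), (pB b c (- r) m n); split=> //; exact: pinv_B.
Qed.

Lemma adj_is_pop A : is_pop A -> is_pop (adj A).
Proof.
by move=> [p [q [pq ->]]]; exists q, p; rewrite (adj_pop pq); split=> //; exact: pinvC.
Qed.

Lemma adjK A : is_pop A -> adj (adj A) = A.
Proof. by move=> [p [q [pq ->]]]; rewrite (adj_pop pq) (adj_pop (pinvC pq)). Qed.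

Lemma adj_comp A B : is_pop A -> is_pop B -> adj (A \o B) = adj B \o adj A.
Proof.
move=> [p [q [pq ->]]] [p' [q' [pq' ->]]]; rewrite (pop_comp pq pq').
rewrite (adj_pop (pinv_comp pq pq')) (adj_pop pq) (adj_pop pq').
by rewrite (pop_comp (pinvC pq') (pinvC pq)).
Qed.

Lemma pcomp_id (p q : idx -> option idx) i j :
  pinv p q -> pcomp p q i = Some j -> j = i.
Proof.
by rewrite /pcomp => pq; case E : (p i) => [k|//]/=; move/pq : E => -> [].
Qed.

Lemma is_pop_regular A : is_pop A -> A \o (adj A \o A) = A.
Proof.
move=> [p [q [pq ->]]]; rewrite (adj_pop pq) (pop_comp (pinvC pq) pq).
rewrite (pop_comp pq (pinv_comp (pinvC pq) pq)).
congr pop; apply/funext => i; rewrite /pcomp.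
by case E : (p i) => [j|//]/=; move/pq : (E) => ->.
Qed.

Lemma adj_ran A : is_pop A -> adj (A \o adj A) = A \o adj A.
Proof.
by move=> hA; rewrite adj_comp//; [rewrite adjK|exact: adj_is_pop].
Qed.

Lemma proj_diag A : is_pop A -> adj A = A -> A \o A = A ->
  exists d : idx -> option idx,
    [/\ pinv d d, forall i j, d i = Some j -> j = i & A = pop d].
Proof.
move=> [p [q [pq ->]]] Aa AA; exists (pcomp p q); split.
- exact: pinv_comp pq (pinvC pq).
- by move=> i j; exact: pcomp_id.
- by rewrite -[LHS]AA -{2}Aa (adj_pop pq) (pop_comp pq (pinvC pq)).
Qed.

Lemma proj_comm A B : is_pop A -> adj A = A -> A \o A = A ->
  is_pop B -> adj B = B -> B \o B = B -> A \o B = B \o A.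
Proof.
move=> hA Aa AA hB Ba BB.
have [d [dd did ->]] := proj_diag hA Aa AA.
have [d' [dd' did' ->]] := proj_diag hB Ba BB.
rewrite (pop_comp dd dd') (pop_comp dd' dd); congr pop; apply/funext => i.
rewrite /pcomp; case E : (d i) => [j|]; case E' : (d' i) => [j'|] //=.
- by have ? := did _ _ E; have ? := did' _ _ E'; subst; rewrite E E'.
- by have ? := did _ _ E; subst; rewrite E'.
- by have ? := did' _ _ E'; subst; rewrite E.
Qed.

Lemma inT_0 : inT ((op0 : op R idx)). Proof. by left. Qed.

Lemma inT_1 : inT (id : op R idx).
Proof.
apply/inTP; right; exists false, false, 0, (0%N, 0%N), (0%N, 0%N); split=> //.
rewrite -pop_id; congr pop; apply/funext => -[[i j] k].
by rewrite /pB /ptens/= /pleg/= !subn0 !addn0 addr0.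
Qed.

Lemma inT_adj (A : op R idx) : inT A -> inT (adj A).
Proof.
move=> /inTP[->|[b [c [r [n [m [h ->]]]]]]].
  by left; rewrite op0_pop (@adj_pop _ _ _ (fun=> None)).
apply/inTP; right; exists b, c, (- r), m, n; split; last exact: adj_pop (pinv_B _ _ _ _ _).
by case: b c h => -[] //=; lia.
Qed.

Lemma inT_comp (A B : op R idx) : inT A -> inT B -> inT (A \o B).
Proof.
move=> /inTP[->|[b [c [r [n [m [h ->]]]]]]].
  by move=> _; left.
move=> /inTP[->|[b' [c' [r' [n' [m' [h' ->]]]]]]].
  left; rewrite op0_pop (pop_comp (pinv_B _ _ _ _ _) (q' := fun=> None))//.
  by congr pop; apply/funext => i; rewrite /pcomp; case: pB.
rewrite (pop_comp (pinv_B _ _ _ _ _) (pinv_B _ _ _ _ _)).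
have E : pcomp (pB b c r n m) (pB b' c' r' n' m') = fun i =>
    if leg_dead b b' m.1 n'.1 || leg_dead c c' m.2 n'.2 then None else
    pB (b || b') (c || c') (r + r') (n.1 + (n'.1 - m.1), n.2 + (n'.2 - m.2))%N
      (m'.1 + (m.1 - n'.1), m'.2 + (m.2 - n'.2))%N i.
  apply/funext => -[[i j] k].
  have := pcomp_leg b b' n.1 m.1 n'.1 m'.1 i.
  have := pcomp_leg c c' n.2 m.2 n'.2 m'.2 j.
  rewrite /pcomp /pB /ptens/=.
  set dc := leg_dead c c' _ _; set db := leg_dead b b' _ _.
  set lb := pleg (b || b') _ _ i; set lc := pleg (c || c') _ _ j.
  clearbody dc db lb lc.
  case: (pleg b n.1 m.1 i) => [i'|]; case: (pleg c n.2 m.2 j) => [j'|] /= Hc Hb;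
    rewrite ?Hb ?Hc; move: Hb Hc; case: db; case: dc => //= Hb Hc;
    by case: lb Hb => [?|] //= Hb; case: lc Hc => [?|] //= Hc; rewrite addrA.
rewrite {}E; case D : (_ || _); first by left; rewrite op0_pop.
move/negbT: D.
rewrite negb_or => /andP[d1 d2]; apply/inTP; right.
do 5 eexists; split; last by reflexivity.
by move: h h' d1 d2; rewrite /leg_dead; case: b; case: c; case: b'; case: c' => //=; lia.
Qed.

Definition semigroupT : Type := set_type (@inT R).

Definition opT (s : semigroupT) : op R idx := set_val s.

Lemma opTP (s : semigroupT) : inT (opT s). Proof. exact: (set_mem (valP s)). Qed.

Lemma opT_is_pop (s : semigroupT) : is_pop (opT s). Proof. exact/inT_pop/opTP. Qed.

Lemma opT_inj : injective opT. Proof. exact: val_inj. Qed.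

Definition tzero : semigroupT := set_elt inT_0.
Definition tone : semigroupT := set_elt inT_1.
Definition tmul (s t : semigroupT) : semigroupT := set_elt (inT_comp (opTP s) (opTP t)).
Definition tstar (s : semigroupT) : semigroupT := set_elt (inT_adj (opTP s)).

Lemma tmulA : associative tmul. Proof. by move=> s t u; exact: opT_inj. Qed.

Lemma tmul0 s : tmul tzero s = tzero. Proof. exact: opT_inj. Qed.

Lemma tmulr0 s : tmul s tzero = tzero.
Proof.
apply: opT_inj; have [p [q [pq sE]]] := opT_is_pop s.
change (opT s \o op0 = op0); rewrite sE op0_pop (pop_comp (q' := fun=> None) pq)//.
by congr pop; apply/funext => i; rewrite /pcomp; case: (p i).
Qed.

Lemma tmul1 s : tmul tone s = s. Proof. exact: opT_inj. Qed.

Lemma tmulr1 s : tmul s tone = s. Proof. exact: opT_inj. Qed.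

Lemma tstarK : involutive tstar.
Proof. by move=> s; apply: opT_inj; exact: adjK (opT_is_pop s). Qed.

Lemma tstarM s t : tstar (tmul s t) = tmul (tstar t) (tstar s).
Proof. by apply: opT_inj; exact: adj_comp (opT_is_pop s) (opT_is_pop t). Qed.

Lemma tmul_regular s : tmul s (tmul (tstar s) s) = s.
Proof. by apply: opT_inj; exact: is_pop_regular (opT_is_pop s). Qed.

Lemma tstar0 : tstar tzero = tzero.
Proof. by rewrite -[RHS]tstarK -[in RHS](tmul0 (tstar tzero)) tstarM tstarK tmul0. Qed.

Definition is_projection (e : semigroupT) : Prop := tstar e = e /\ tmul e e = e.

Definition semilatticeE : Type := set_type is_projection.

Definition eval (e : semilatticeE) : semigroupT := set_val e.

Lemma evalP (e : semilatticeE) : is_projection (eval e).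
Proof. exact: (set_mem (valP e)). Qed.

Lemma eval_inj : injective eval. Proof. exact: val_inj. Qed.

Lemma projection_comm s t : is_projection s -> is_projection t -> tmul s t = tmul t s.
Proof.
move=> [sa ss] [ta tt]; apply: opT_inj.
exact: (proj_comm (opT_is_pop s) (congr1 opT sa) (congr1 opT ss)
  (opT_is_pop t) (congr1 opT ta) (congr1 opT tt)).
Qed.

Lemma projectionM s t : is_projection s -> is_projection t -> is_projection (tmul s t).
Proof.
move=> sp tp; have st := projection_comm sp tp; split.
  by rewrite tstarM (proj1 sp) (proj1 tp).
have tst : tmul t (tmul s t) = tmul s t by rewrite st tmulA (proj2 tp).
by rewrite -tmulA tst tmulA (proj2 sp).
Qed.

Lemma projection0 : is_projection tzero. Proof. by split; [exact: tstar0|exact: tmul0]. Qed.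

Lemma projection_conj s e : is_projection e -> is_projection (tmul s (tmul e (tstar s))).
Proof.
move=> ep; split; first by rewrite !tstarM tstarK (proj1 ep) tmulA.
have sp : is_projection (tmul (tstar s) s).
  by split; [rewrite tstarM tstarK|rewrite -tmulA tmul_regular].
have ese : tmul e (tmul (tmul (tstar s) s) e) = tmul (tmul (tstar s) s) e.
  by rewrite -(projection_comm ep sp) tmulA (proj2 ep).
transitivity (tmul s (tmul (tmul e (tmul (tmul (tstar s) s) e)) (tstar s))).
  by rewrite !tmulA.
by rewrite ese -(tmulA _ e) (tmulA s) tmul_regular.
Qed.

Definition ezero : semilatticeE := set_elt projection0.
Definition emul (e f : semilatticeE) : semilatticeE := set_elt (projectionM (evalP e) (evalP f)).
Definition ele (e f : semilatticeE) : Prop := emul f e = e.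

(* s e s^* *)
Definition econj (s : semigroupT) (e : semilatticeE) : semilatticeE := set_elt (projection_conj s (evalP e)).

Lemma projection_ran s : is_projection (tmul s (tstar s)).
Proof.
split; first by rewrite tstarM tstarK.
by rewrite tmulA -(tmulA s (tstar s) s) tmul_regular.
Qed.

(* s s^* *)
Definition eran (s : semigroupT) : semilatticeE := set_elt (projection_ran s).

Definition is_filter (A : set semilatticeE) : Prop :=
  [/\ A !=set0, ~ A ezero, (forall e f, A e -> ele e f -> A f)
    & (forall e f, A e -> A f -> A (emul e f))].

Definition is_ultrafilter (A : set semilatticeE) : Prop :=
  is_filter A /\ forall B, is_filter B -> A `<=` B -> B = A.

Definition is_character (x : {ptws semilatticeE -> bool}) : Prop :=
  [/\ exists e, x e = true, (forall e f, x (emul e f) = x e && x f) & x ezero = false].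

Definition Ehat0 : topologicalType := set_type is_character.

Definition char_fun (x : Ehat0) : semilatticeE -> bool := set_val x.

Lemma char_funP (x : Ehat0) : is_character (char_fun x).
Proof. exact: (set_mem (valP x)). Qed.

Definition Ehat_infty : set Ehat0 :=
  [set x | is_ultrafilter [set e | char_fun x e = true]].

Definition Ehat_tight : set Ehat0 := closure Ehat_infty.

Definition domT (s : semigroupT) : set Ehat0 := [set x | char_fun x (eran s) = true].

(* The pairs (x, s) with x in D_s; elements of [germ] are their classes. *)
Definition Sigma : Type :=
  set_type [set p : (Ehat0 * semigroupT)%type | domT p.2 p.1].

HB.instance Definition _ := Choice.on Sigma.

Definition unit_of (p : Sigma) : Ehat0 := (set_val p).1.
Definition elt_of (p : Sigma) : semigroupT := (set_val p).2.

Lemma SigmaP (p : Sigma) : domT (elt_of p) (unit_of p).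
Proof. exact: (set_mem (valP p)). Qed.

Lemma tconjM s e f :
  emul (econj s e) (econj s f) = econj s (emul e f).
Proof.
apply: eval_inj; change (tmul (tmul s (tmul (eval e) (tstar s))) (tmul s (tmul (eval f) (tstar s)))
  = tmul s (tmul (tmul (eval e) (eval f)) (tstar s))).
have sp : is_projection (tmul (tstar s) s).
  by split; [rewrite tstarM tstarK|rewrite -tmulA tmul_regular].
transitivity (tmul s (tmul (tmul (eval e) (tmul (tstar s) s)) (tmul (eval f) (tstar s)))).
  by rewrite !tmulA.
rewrite (projection_comm (evalP e) sp) -!tmulA (tmulA (tstar s) s) (tmulA s).
by rewrite tmul_regular.
Qed.

Lemma act_subproof (p : Sigma) :
  is_character (fun e => char_fun (unit_of p) (econj (elt_of p) e)).
Proof.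
have [_ xM x0] := char_funP (unit_of p); set s := elt_of p; split.
- have sp : is_projection (tmul (tstar s) s).
    by split; [rewrite tstarM tstarK|rewrite -tmulA tmul_regular].
  exists (set_elt sp); have := SigmaP p; rewrite /domT/= -/s => <-; congr char_fun.
  apply: eval_inj; change (tmul s (tmul (tmul (tstar s) s) (tstar s)) = tmul s (tstar s)).
  by rewrite tmulA tmul_regular.
- by move=> e f; rewrite -xM tconjM.
- rewrite -x0; congr char_fun; apply: eval_inj.
  by change (tmul s (tmul tzero (tstar s)) = tzero); rewrite tmul0 tmulr0.
Qed.

(* (x . s)(e) = x(s e s^* ) *)
Definition act (p : Sigma) : Ehat0 := set_elt (act_subproof p).

Definition germ_eq (p q : Sigma) : Prop :=
  unit_of p = unit_of q /\
  exists e : semilatticeE, char_fun (unit_of p) e = true /\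
    tmul (eval e) (elt_of p) = tmul (eval e) (elt_of q).

Definition germ_rel : rel Sigma := fun p q => `[< germ_eq p q >].

Lemma germ_rel_refl : reflexive germ_rel.
Proof.
move=> p; apply/asboolP; split=> //.
by have [[e xe] _ _] := char_funP (unit_of p); exists e.
Qed.

Lemma germ_eqC p q : germ_eq p q -> germ_eq q p.
Proof. by move=> [pq [e [xe E]]]; split; [|exists e; rewrite -pq]. Qed.

Lemma germ_rel_sym : symmetric germ_rel.
Proof. by move=> p q; apply: asbool_equiv_eq; split; exact: germ_eqC. Qed.

Lemma germ_rel_trans : transitive germ_rel.
Proof.
move=> q p r /asboolP[pq [e [xe E]]] /asboolP[qr [f [xf F]]]; apply/asboolP.
split; first by rewrite pq.
exists (emul f e); have [_ xM _] := char_funP (unit_of p); split.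
  by rewrite xM xe pq xf.
change (tmul (tmul (eval f) (eval e)) (elt_of p) = tmul (tmul (eval f) (eval e)) (elt_of r)).
rewrite -tmulA E tmulA (projection_comm (evalP f) (evalP e)) -tmulA F.
by rewrite tmulA.
Qed.

Canonical germ_equiv := EquivRel germ_rel germ_rel_refl germ_rel_sym germ_rel_trans.

Definition germ : Type := {eq_quot germ_equiv}%qT.

HB.instance Definition _ := Choice.on germ.
HB.instance Definition _ := EqQuotient.on germ.

Definition germ_of (p : Sigma) : germ := \pi_germ%qT p.

Lemma germ_ofP p q : germ_of p = germ_of q <-> germ_eq p q.
Proof. by split=> [/eqP|h]; [rewrite eqmodE => /asboolP|apply/eqP; rewrite eqmodE; apply/asboolP]. Qed.

Definition rng (g : germ) : Ehat0 := unit_of (repr g).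
Definition src (g : germ) : Ehat0 := act (repr g).

Lemma germ_repr p : germ_eq (repr (germ_of p)) p.
Proof. by apply/germ_ofP; rewrite /germ_of reprK. Qed.

Lemma rngE p : rng (germ_of p) = unit_of p.
Proof. by have [] := germ_repr p. Qed.

Lemma act_germ p q : germ_eq p q -> act p = act q.
Proof.
move=> [pq [e [xe es]]]; apply: val_inj; apply/funext => f /=.
change (char_fun (unit_of p) (econj (elt_of p) f) = char_fun (unit_of q) (econj (elt_of q) f)).
have [_ xM _] := char_funP (unit_of p).
have H (s : semigroupT) : char_fun (unit_of p) (econj s f) =
    char_fun (unit_of p) (econj (tmul (eval e) s) f).
  rewrite -[LHS]andTb -xe -[LHS]andbT -[in X in _ && X]xe -!xM; congr char_fun.
  apply: eval_inj; change (tmul (tmul (eval e) (tmul s (tmul (eval f) (tstar s)))) (eval e)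
    = tmul (tmul (eval e) s) (tmul (eval f) (tstar (tmul (eval e) s)))).
  by rewrite tstarM (proj1 (evalP e)) !tmulA.
by rewrite H es -H pq.
Qed.

Lemma srcE p : src (germ_of p) = act p.
Proof. exact/act_germ/germ_repr. Qed.

Definition Theta (U : set Ehat0) (s : semigroupT) : set germ :=
  [set germ_of p | p in [set p | U (unit_of p) /\ elt_of p = s]].

Definition Theta_index : Type := (set Ehat0 * semigroupT)%type.

HB.instance Definition _ := Choice.on Theta_index.
HB.instance Definition _ := isPointed.Build Theta_index (set0, tzero).

Definition Theta_dom : set Theta_index :=
  [set i | open i.1 /\ i.1 `<=` domT i.2].

Lemma open_char (e : semilatticeE) : open [set x : Ehat0 | char_fun x e = true].
Proof.
have c : continuous (fun x : Ehat0 => char_fun x e).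
  move=> x; apply: (@continuous_comp Ehat0 {ptws semilatticeE -> bool} bool set_val (proj e)).
    exact: initial_continuous.
  exact: proj_continuous.
exact: (open_comp (D := [set b | b = true]) (fun x _ => c x) (discrete_open _)).
Qed.

Lemma Theta_cover : \bigcup_(i in Theta_dom) Theta i.1 i.2 = setT.
Proof.
apply/seteqP; split=> // g _.
exists (domT (elt_of (repr g)), elt_of (repr g)); first by split=> //; exact: open_char.
by exists (repr g); [split=> //; exact: SigmaP|rewrite /germ_of reprK].
Qed.

Lemma Theta_join i j g : Theta_dom i -> Theta_dom j ->
  Theta i.1 i.2 g -> Theta j.1 j.2 g ->
  exists k, [/\ Theta_dom k, Theta k.1 k.2 g &
    Theta k.1 k.2 `<=` Theta i.1 i.2 `&` Theta j.1 j.2].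
Proof.
move=> [oi di] [oj dj] [p [pi si] pg] [q [qj sj] qg].
have /germ_ofP[pq [e [xe es]]] : germ_of p = germ_of q by rewrite pg qg.
exists (i.1 `&` j.1 `&` [set x : Ehat0 | char_fun x e = true], i.2); split => /=.
- split; first by apply: openI; [exact: openI|exact: open_char].
  by move=> x [[/di]].
- by exists p => //; split=> //; split=> //; split=> //; rewrite pq.
- move=> _ [r [[[ri rj] re] sr] <-]; split; first by exists r.
  have H : domT j.2 (unit_of r) by exact: dj.
  exists (set_elt (A := [set p | domT p.2 p.1]) (x := (unit_of r, j.2)) H) => //.
  apply/germ_ofP; split=> //; exists e; split=> //.
  change (tmul (eval e) j.2 = tmul (eval e) (elt_of r)).
  by rewrite sr -si -sj es.
Qed.

HB.instance Definition _ := isBaseTopological.Build germ Theta_cover Theta_join.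

Definition Gtight : topologicalType :=
  set_type [set g : germ | Ehat_tight (rng g) /\ Ehat_tight (src g)].

End InverseSemigroup.

(* Main.v *)
(* Every element of T acts on the index set N x N x Z as a partial translation,
   so two elements that agree at one index agree wherever both are defined.
   Hence if e s = e t is nonzero, then (t t^* ) s = (s s^* ) t: as soon as the
   germs of s and t coincide at one character, they coincide at every common
   character of D_s and D_t. Distinct germs [(x, s)], [(x, t)] are therefore
   separated by Theta(D_s, s) and Theta(D_t, t), and the whole groupoid of germs
   is already Hausdorff. *)
Require Import Defs.
From mathcomp Require Import all_boot all_order all_algebra.
From mathcomp Require Import all_classical all_reals topology.
From mathcomp Require Import zify complex.

Set Implicit Arguments.
Unset Strict Implicit.
Unset Printing Implicit Defensive.

Import Defs GRing.Theory.

Local Open Scope classical_set_scope.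
Local Open Scope ring_scope.
Local Open Scope complex_scope.

(** The displacement depends on the parameters alone. On the N-legs it is written additively, since
    subtraction in [nat] truncates. *)
Lemma pB_translation b c r n m i j : pB b c r n m i = Some j ->
  [/\ (j.1.1 + n.1 = i.1.1 + m.1)%N, (j.1.2 + n.2 = i.1.2 + m.2)%N & j.2 = i.2 + r].
Proof.
case: i => -[i1 i2] i3; rewrite /pB /ptens /pleg /ptrans /=.
case: ifP => //= h1; case: ifP => //= h2 [<-] /=.
by split=> //; [case: b h1|case: c h2] => h; lia.
Qed.

(** Agreement at [i] forces equal displacements on all three legs, and these determine the image of
    [k]. *)
Lemma pB_agree b c r n m b' c' r' n' m' i j k l l' :
  pB b c r n m i = Some j -> pB b' c' r' n' m' i = Some j ->
  pB b c r n m k = Some l -> pB b' c' r' n' m' k = Some l' -> l = l'.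
Proof.
move=> /pB_translation[a1 a2 a3] /pB_translation[b1 b2 b3].
move=> /pB_translation[c1 c2 c3] /pB_translation[d1 d2 d3].
case: l l' c1 c2 c3 d1 d2 d3 => -[l1 l2] l3 [[l1' l2'] l3'] /= *.
by congr (_, _, _); lia.
Qed.

(** Used to pass from all germs to the tight reduction, along the inclusion. *)
Lemma injective_hausdorff (X Y : topologicalType) (f : X -> Y) :
  injective f -> continuous f -> hausdorff_space Y -> hausdorff_space X.
Proof.
move=> fI fc hY x y xy; apply/fI/hY => A B /fc fA /fc fB.
by have [z [Az Bz]] := xy _ _ fA fB; exists (f z).
Qed.

Section Germs.
Variable R : realType.

(** Coordinate [i] of the image of the basis vector at [j] is 1 if [p i = Some j] and 0 otherwise,
    so the operator recovers [p]. *)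
Lemma pop_inj (I : choiceType) (p p' q q' : I -> option I) :
  pinv p p' -> pinv q q' -> @pop R I p = pop q -> p = q.
Proof.
move=> pp qq pq; apply/funext => i.
have E j : (p i == Some j) = (q i == Some j).
  have := congr1 (fun A => seq_of (A (ell2_of (fun k => (k == j)%:R : R[i]))) i) pq.
  rewrite (popE _ pp) (popE _ qq) /pfun.
  case: (p i) (q i) => [k|] [l|] //=; rewrite ?ell2_ofE; try exact: delta_sq.
  - rewrite !(inj_eq Some_inj); do 2 case: (_ == j) => //=.
      by move/eqP; rewrite oner_eq0.
    by move/eqP; rewrite eq_sym oner_eq0.
  - by rewrite (inj_eq Some_inj); case: (_ == j) => //= /eqP; rewrite oner_eq0.
  - by rewrite (inj_eq Some_inj); case: (_ == j) => //= /eqP; rewrite eq_sym oner_eq0.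
case F : (p i) => [k|]; first by apply/esym/eqP; rewrite -E F.
by case G : (q i) => [k|//]; move: (E k); rewrite F G eqxx.
Qed.

Implicit Types (s t : semigroupT R) (x : Ehat0 R).

(** Both sides are restrictions to the common domain of the partial injections of [s] and [t], where
    these coincide once they agree at a single index. *)
Lemma tmul_agree s t e : is_projection e -> tmul e s = tmul e t ->
  tmul e s <> tzero R -> tmul (tmul t (tstar t)) s = tmul (tmul s (tstar s)) t.
Proof.
move=> [ea ee] est es0.
have [d [dd did eE]] := proj_diag (opT_is_pop e) (congr1 (@opT R) ea) (congr1 (@opT R) ee).
have E : opT e \o opT s = opT e \o opT t := congr1 (@opT R) est.
rewrite eE in E.
have [sE|[b [c [r [n [m [_ sE]]]]]]] := (inTP (opT s)).1 (opTP s).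
  by case: es0; rewrite (opT_inj (sE : opT s = opT (tzero R))) tmulr0.
have [tE|[b' [c' [r' [n' [m' [_ tE]]]]]]] := (inTP (opT t)).1 (opTP t).
  case: es0; apply: opT_inj; change (opT e \o opT s = opT (tzero R)); rewrite eE E tE.
  by rewrite -eE; change (opT (tmul e (tzero R)) = opT (tzero R)); rewrite tmulr0.
have ps := pinv_B b c r n m; have pt := pinv_B b' c' r' n' m'.
move: E; rewrite sE tE (pop_comp dd ps) (pop_comp dd pt).
move/(pop_inj (pinv_comp dd ps) (pinv_comp dd pt)) => E.
(* The map [d] of [e] is a partial identity, so any index where [e s] is defined will do; without
   one, [e s] would be zero. *)
have [i [j [si ti]]] : exists i j,
    pB b c r n m i = Some j /\ pB b' c' r' n' m' i = Some j.
  apply: contrapT => H; apply: es0; apply: opT_inj.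
  change (opT e \o opT s = @op0 R idx); rewrite eE sE (pop_comp dd ps) op0_pop.
  congr pop; apply/funext => i; case F : (pcomp d (pB b c r n m) i) => [j|//]; case: H; exists i, j.
  have := congr1 (fun f => f i) E; rewrite F; move: F; rewrite /pcomp.
  by case G : (d i) => [k|//]; rewrite (did _ _ G) /= => -> <-.
apply: opT_inj.
change ((opT t \o adj (opT t)) \o opT s = (opT s \o adj (opT s)) \o opT t).
rewrite sE tE (adj_pop ps) (adj_pop pt) (pop_comp pt (pinvC pt)) (pop_comp ps (pinvC ps)).
rewrite (pop_comp (pinv_comp pt (pinvC pt)) ps) (pop_comp (pinv_comp ps (pinvC ps)) pt).
congr pop; apply/funext => k; rewrite /pcomp.
case F : (pB b c r n m k) => [l|]; case G : (pB b' c' r' n' m' k) => [l'|] //=.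
- rewrite (pt k l').1 // (ps k l).1 //= F G; congr Some.
  exact: pB_agree si ti F G.
- by rewrite (ps k l).1 //= G.
- by rewrite (pt k l').1 //= F.
Qed.

(** Transfers equality of germs from the character of [p'] and [q'] to that of [p] and [q]. *)
Lemma germ_eq_agree (p q p' q' : Sigma R) :
  elt_of p' = elt_of p -> elt_of q' = elt_of q ->
  germ_eq p' q' -> unit_of p = unit_of q -> germ_eq p q.
Proof.
move=> ps qt [yy [e [ye E]]] xx; split=> //.
set s := elt_of p in ps *; set t := elt_of q in qt *; rewrite ps qt in E.
(* The character of [p'] is 1 at [e] and at [s s^*], hence at their product, which therefore is not
   0. *)
have es0 : tmul (eval e) s <> tzero R.
  move=> es; have [_ yM y0] := char_funP (unit_of p').
  have := SigmaP p'; rewrite /domT /= ps => ys.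
  suff : char_fun (unit_of p') (ezero R) = true by rewrite y0.
  rewrite -[RHS]/(true && true) -{1}ye -ys -yM; congr char_fun; apply: eval_inj.
  by change (tzero R = tmul (eval e) (tmul s (tstar s))); rewrite tmulA es tmul0.
have st := tmul_agree (evalP e) E es0.
have [_ xM _] := char_funP (unit_of p).
(* With this witness, both products reduce to [s s^* t]. *)
exists (emul (eran s) (eran t)); split.
  by rewrite xM (SigmaP p : char_fun _ (eran s) = true) xx; exact: (SigmaP q).
have rs := projection_ran s.
change (tmul (tmul (tmul s (tstar s)) (tmul t (tstar t))) s
  = tmul (tmul (tmul s (tstar s)) (tmul t (tstar t))) t).
rewrite -[LHS]tmulA st [LHS]tmulA (proj2 rs) -[RHS]tmulA; congr (tmul _ _).
by rewrite -tmulA tmul_regular.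
Qed.

(** The value [false] is covered too: two characters that differ at [e] are separated by one
    condition of each kind. *)
Lemma open_char_eq (e : semilatticeE R) b : open [set x | char_fun x e = b].
Proof.
have c : continuous (fun x => char_fun x e).
  move=> x; apply: (@continuous_comp _ {ptws semilatticeE R -> bool} bool set_val (proj e)).
    exact: initial_continuous.
  exact: proj_continuous.
exact: (open_comp (D := [set b' | b' = b]) (fun x _ => c x) (discrete_open _)).
Qed.

Lemma nbhs_Theta (p : Sigma R) (U : set (Ehat0 R)) : open U -> U (unit_of p) ->
  nbhs (germ_of p) (Theta (U `&` domT (elt_of p)) (elt_of p)).
Proof.
move=> oU Up; apply: open_nbhs_nbhs; split; last first.
  by exists p => //; split=> //; split=> //; exact: SigmaP.
exists [set (U `&` domT (elt_of p), elt_of p)]; last by rewrite bigcup_set1.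
by move=> _ ->; split=> /= [|x []//]; apply: openI => //; exact: open_char.
Qed.

Lemma germ_hausdorff : hausdorff_space (germ R).
Proof.
move=> g h; have [p <-] : exists p, germ_of p = g by exists (repr g); exact: reprK.
have [q <-] : exists q, germ_of q = h by exists (repr h); exact: reprK.
move=> gh.
have xx : unit_of p = unit_of q.
  apply: val_inj; apply/funext => e.
  change (char_fun (unit_of p) e = char_fun (unit_of q) e).
  (* A germ common to both neighbourhoods has a single range, whose value at [e] is that of both
     characters. *)
  have [_ [[p' [[pe _] _] <-] [q' [[qe _] _] /germ_ofP[pq _]]]] := gh _ _
    (nbhs_Theta (open_char_eq e (char_fun (unit_of p) e)) erefl)
    (nbhs_Theta (open_char_eq e (char_fun (unit_of q) e)) erefl).
  by rewrite -pe -qe pq.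
(* The largest basic neighbourhoods suffice: one common germ, at any character, feeds
   [germ_eq_agree]. *)
have [_ [[p' [_ ps] <-] [q' [_ qt] /germ_ofP pq]]] := gh _ _
  (nbhs_Theta openT (I : setT (unit_of p))) (nbhs_Theta openT (I : setT (unit_of q))).
by apply/germ_ofP; apply: germ_eq_agree ps qt (germ_eqC pq) xx.
Qed.

End Germs.

Theorem proposition4p4 (R : realType) : hausdorff_space (Gtight R).
Proof.
apply: (@injective_hausdorff _ (germ R) set_val val_inj _ (@germ_hausdorff R)).
exact: initial_continuous.
Qed.
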